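(* For each positive integer $n$, let $\pi_n$ and $\pi_n'$ be independent, uniformly random permutations of $\{1,\dots,n\}$. Then \[ \limsup_{n\to\infty} n^{2}\, \mathbf{P}(\operatorname{ord} \pi_n = \operatorname{ord} \pi_n') = \infty. \]
   Context: For a permutation $\pi$, $\operatorname{ord}\pi$ denotes its order in the symmetric group, i.e. the least common multiple of its cycle lengths. *)

(* Defs.v *)
From HB Require Import structures.
From mathcomp Require Export all_boot all_order all_algebra all_fingroup.
From mathcomp Require Export all_classical all_reals all_analysis.

Set Implicit Arguments.
Unset Strict Implicit.
Unset Printing Implicit Defensive.

Import Order.TTheory GRing.Theory Num.Theory.
Local Open Scope classical_set_scope.
Local Open Scope ring_scope.
Local Open Scope ereal_scope.

(* The finite type F carries the discrete sigma-algebra. *)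
Definition random_element (d : measure_display) (T : measurableType d)
    (F : finType) (X : T -> F) : Prop :=
  forall A : set F, measurable (X @^-1` A).

Definition uniformly_distributed (R : realType) (d : measure_display)
    (T : measurableType d) (P : probability T R) (F : finType)
    (X : T -> F) : Prop :=
  forall x : F, P (X @^-1` [set x]) = ((#|F|%:R : R)^-1)%:E.

Definition independent_elements (R : realType) (d : measure_display)
    (T : measurableType d) (P : probability T R) (F G : finType)
    (X : T -> F) (Y : T -> G) : Prop :=
  forall (A : set F) (B : set G),
    P (X @^-1` A `&` Y @^-1` B) = P (X @^-1` A) * P (Y @^-1` B).

(* Main.v *)
Require Import Defs.
From mathcomp Require Import cyclic.
Import Order.TTheory GRing.Theory Num.Theory.

(** If [m! %| n - m], every permutation of [n] points containing an
    [(n - m)]-cycle has order exactly [n - m], since the order of the rest of the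
    permutation divides [m!]; a given point lies in a cycle of length [n - m] with
    probability [1 / n], so the order is [n - m] with probability at least [1 / n].
    Along the sequence [m_0 = 0], [m_(k+1) = m_k + m_k!], each [m_i!] divides
    [m_K - m_i] for [i < K].  Hence for [n = m_K] there are [K] distinct values
    [n - m_i] each taken by the order with probability at least [1 / n], and the
    two orders agree with probability at least [K / n ^ 2]. *)

(** Enough such permutations arise as conjugates, by some [t] fixing [x], of [r * c], where [c] is a
    full cycle on [S] and [r] moves only points outside [S]. The pairs [(t, r)] number (|T| - 1)!
    |~S|!, and each permutation comes from at most |~S|! of them. *)
Lemma card_perm_order_ge (T : finType) (S : {set T}) (x : T) :
  x \in S -> ((#|~: S|)`! %| #|S|)%N ->
  ((#|T|.-1)`! <= #|[set s : {perm T} | #[s]%g == #|S|]|)%N.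
Proof.
move=> xS dvdS.
(* [next] fixes whatever is not in the list, so [c] cycles through [S] and is the identity
   elsewhere. *)
pose c : {perm T} := perm (can_inj (prev_next (enum_uniq S))).
have cE y : c y = next (enum S) y by rewrite permE.
have cycS : fcycle c (enum S).
  by rewrite (eq_fcycle (f' := next (enum S))) ?cycle_next ?enum_uniq.
have con_c : perm_on S c.
  apply/fintype.subsetP => y; rewrite inE cE; apply: contraR.
  by move=> yS; rewrite next_nth mem_enum (negbTE yS).
have cS y i : y \in S -> iter i c y \in S.
  by move=> yS; elim: i => //= i; rewrite (perm_closed _ con_c).
have orbS y : y \in S -> exists i, y = iter i c x.
  move=> yS; have /iter_findex <- : fconnect c x y.
    by rewrite (fconnect_cycle cycS) ?mem_enum.
  by exists (findex c x y).
have cX : (c ^+ #|S| = 1)%g.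
  apply/permP => y; rewrite permX perm1.
  have [yS|yS] := boolP (y \in S).
    have := order_cycle cycS (enum_uniq S) (x := y).
    rewrite mem_enum -cardE => /(_ yS) <-.
    by rewrite iter_order //; exact: perm_inj.
  by elim: #|S| => //= k ->; rewrite (out_perm con_c).
have mulE (r : {perm T}) : r \in Sym (~: S) -> forall y i, y \in S ->
    ((r * c) ^+ i)%g y = iter i c y.
  rewrite inE => ron y i yS; rewrite permX; elim: i => //= i ->.
  by rewrite permM (out_perm ron) // inE negbK cS.
have ordE (r : {perm T}) : r \in Sym (~: S) -> #[(r * c)%g]%g = #|S|.
  (* Upper bound: [r] and [c] commute, having disjoint supports, and the order of [r] divides |~S|!,
     hence |S|. Lower bound: the powers of [r * c] carry [x] to every point of [S]. *)
  move=> rS; apply/eqP; rewrite eqn_leq; apply/andP; split.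
    apply: dvdn_leq; first by apply/card_gt0P; exists x.
    rewrite order_dvdn expgMn.
      rewrite cX mulg1 -order_dvdn.
      by apply: dvdn_trans dvdS; rewrite -card_Sym; exact: order_dvdG.
    move: rS; rewrite inE => ron; apply: (perm_onC ron con_c).
    by rewrite finset.disjoints_subset.
  rewrite orderE; apply: leq_trans (leq_imset_card (aperm x) _).
  apply/subset_leq_card/fintype.subsetP => y /orbS[i ->].
  by apply/imsetP; exists ((r * c) ^+ i)%g; [exact: mem_cycle|rewrite /aperm mulE].
pose X := finset.setX (Sym [set~ x]) (Sym (~: S)).
pose f (p : {perm T} * {perm T}) := ((p.2 * c) ^ p.1)%g.
have cardX : #|X| = ((#|T|.-1)`! * (#|~: S|)`!)%N.
  by rewrite cardsX !card_Sym cardsC1.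
have fsub : f @: X \subset [set s : {perm T} | #[s]%g == #|S|].
  apply/fintype.subsetP => _ /imsetP[[t r] /finset.setXP[_ rS] ->].
  by rewrite inE orderJ ordE.
(* The exponent depends on [y] alone: if [c ^ i] sends [x] to [y], the [i]-th power of the conjugate
   sends [t' x = x] to [t' y]. *)
have fE y : y \in S ->
    exists i, forall t' r', (t', r') \in X -> t' y = (f (t', r') ^+ i)%g x.
  move=> /orbS[i ->]; exists i => t' r' /finset.setXP[]; rewrite inE => tx rS.
  have t'x : t' x = x by rewrite (out_perm tx) // !inE negbK.
  by rewrite -{2}t'x /f -conjXg permJ mulE.
(* By [fE], [t] is determined on [S] by [f (t, r)], and [t] and [f (t, r)]
   determine [r]; so the fibres of [f] have at most [#|Sym (~: S)|] elements. *)
apply: leq_trans (subset_leq_card fsub).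
rewrite -(leq_pmul2r (fact_gt0 #|~: S|)) -cardX.
rewrite -sum1_card (partition_big_imset f) /= -sum_nat_const.
apply: leq_sum => _ /imsetP[[t0 r0] X0 ->].
rewrite sum1_card -card_Sym.
pose g (p : {perm T} * {perm T}) := (p.1 * t0^-1)%g.
rewrite -(card_in_image (f := g)); last first.
  move=> [t r] [t' r']; rewrite !unfold_in /= => /andP[_ /eqP e1] /andP[_ /eqP e2].
  rewrite /g /= => /mulIg tt; move: e2; rewrite -{}e1 /f /= tt => /conjg_inj/mulIg -> //.
apply/subset_leq_card/fintype.subsetP => _ /fintype.imageP[[t r] + ->].
rewrite unfold_in /= => /andP[tX /eqP e]; rewrite inE.
apply/fintype.subsetP => y; rewrite !inE; apply: contra => yS.
have [i iE] := fE _ yS.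
by rewrite permM (iE _ _ tX) e -(iE _ _ X0) permK.
Qed.

Lemma card_Sn_order_ge (n l : nat) : (0 < l <= n)%N -> ((n - l)`! %| l)%N ->
  (n.-1`! <= #|[set s : 'S_n | #[s]%g == l]|)%N.
Proof.
move=> /andP[l0 ln] dvdl.
pose S := [set widen_ord ln i | i : 'I_l].
have cardS : #|S| = l.
  rewrite card_imset ?card_ord // => i j /(congr1 val)/= ij; exact: val_inj.
have xS : widen_ord ln (Ordinal l0) \in S by exact: imset_f.
have := card_perm_order_ge _ _ _ xS; rewrite cardsCs finset.setCK cardS card_ord.
exact.
Qed.

Fixpoint fact_tower (k : nat) : nat :=
  if k is k'.+1 then (fact_tower k' + (fact_tower k')`!)%N else 0%N.

Lemma fact_tower_lt : {homo fact_tower : i j / (i < j)%N >-> (i < j)%N}.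
Proof.
apply: homo_ltn; first exact: ltn_trans.
by move=> k /=; rewrite -[ltnLHS]addn0 ltn_add2l fact_gt0.
Qed.

Lemma fact_tower_ge (k : nat) : (k <= fact_tower k)%N.
Proof.
by elim: k => // k IH; apply: leq_ltn_trans IH _; exact: fact_tower_lt.
Qed.

(** The difference is a sum of factorials of the later terms [fact_tower (i + k)], and monotonicity
    makes each a multiple of the factorial of [fact_tower i]. *)
Lemma dvdn_fact_tower_sub (i j : nat) : (i <= j)%N ->
  ((fact_tower i)`! %| fact_tower j - fact_tower i)%N.
Proof.
move=> /subnKC <-; elim: (j - i)%N => [|k IH]; first by rewrite addn0 subnn.
have le_ik : (fact_tower i <= fact_tower (i + k))%N.
  by apply: (ltnW_homo fact_tower_lt); exact: leq_addr.
rewrite addnS /= addnC -addnBA // dvdn_add //.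
by rewrite (fact_split le_ik) dvdn_mulr.
Qed.

Local Open Scope classical_set_scope.
Local Open Scope ring_scope.
Local Open Scope ereal_scope.

(** Every tail is unbounded above, so the sequence of tail suprema is constantly [+oo]. *)
Lemma limn_esup_pinfty (R : realType) (u : (\bar R)^nat) :
  (forall N k : nat, exists2 n, (N <= n)%N & k%:R%:E <= u n) ->
  limn_esup u = +oo.
Proof.
move=> uP; rewrite limn_esup_lim.
have -> : esups u = cst +oo; last by exact: lim_cst.
apply/funext => N /=; apply/eqyP => A A0.
have [n Nn kn] := uP N (Num.truncn A).+1.
apply: (@le_trans _ _ (u n)).
  by apply: le_trans kn; rewrite lee_fin; exact/ltW/truncnS_gt.
by apply: ereal_sup_ubound; exists n.
Qed.

Section uniform.
Context (R : realType) (d : measure_display) (T : measurableType d)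
        (P : probability T R) (F : finType).

Lemma probability_uniform_preimage (X : T -> F) (A : {set F}) :
  random_element X -> uniformly_distributed P X ->
  P (X @^-1` [set` A]) = (#|A|%:R / #|F|%:R)%:E.
Proof.
move=> mX uX.
have -> : X @^-1` [set` A] = \bigcup_(x in [set` enum A]) X @^-1` [set x].
  apply/seteqP; split => [w /= wA|w [x /= + ->]].
    by exists (X w) => //=; rewrite mem_enum.
  by rewrite mem_enum.
rewrite measure_fin_bigcup //.
- rewrite -fsbig_seq ?enum_uniq //=.
  under eq_bigr do rewrite uX.
  by rewrite sumEFin big_enum /= sumr_const mulr_natl.
- by move=> x y _ _ [w [/= -> ->]].
Qed.

Lemma measurable_eq_comp (X Y : T -> F) (h : F -> nat) :
  random_element X -> random_element Y ->
  measurable [set w | h (X w) = h (Y w)].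
Proof.
move=> mX mY.
have -> : [set w | h (X w) = h (Y w)] =
    \bigcup_(x in [set: F]) (X @^-1` [set x] `&` Y @^-1` [set y | h x = h y]).
  by apply/seteqP; split => [w hw|w [x _ [<-]]] //; exists (X w).
by apply: fin_bigcup_measurable => // x _; exact: measurableI.
Qed.

(** The events [h X = h Y = l i] are pairwise disjoint because [l] is injective, and by independence
    each has the square of a uniform probability. *)
Lemma probability_eq_comp_ge (X Y : T -> F) (h : F -> nat)
    (K : nat) (l : 'I_K -> nat) :
  random_element X -> random_element Y ->
  uniformly_distributed P X -> uniformly_distributed P Y ->
  independent_elements P X Y -> injective l ->
  (\sum_(i < K) (#|[set x | h x == l i]%SET|%:R / #|F|%:R) ^+ 2)%:E <=
  P [set w | h (X w) = h (Y w)].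
Proof.
move=> mX mY uX uY XY linj.
pose A i := [set x | h x == l i]%SET.
pose E i := X @^-1` [set` A i] `&` Y @^-1` [set` A i].
have mE i : measurable (E i) by exact: measurableI.
have -> : (\sum_(i < K) (#|A i|%:R / #|F|%:R : R) ^+ 2)%:E =
    P (\big[setU/set0]_(i < K) E i).
  rewrite measure_bigsetU_ord //; last first.
    move=> i j _ _ [w [[+ _] [+ _]]].
    by rewrite /= !inE => /eqP -> /eqP /linj.
  rewrite -sumEFin; apply: eq_bigr => i _.
  rewrite -[RHS]/(P (E i)) XY.
  by rewrite !probability_uniform_preimage // -EFinM expr2.
apply: le_measure; rewrite ?inE.
- exact: bigsetU_measurable.
- exact: measurable_eq_comp.
- elim/big_ind: _ => [//|B C sB sC|i _ w []] /=; first by rewrite subUset.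
  by rewrite !inE => /eqP -> /eqP ->.
Qed.
End uniform.

Theorem theorem1 (R : realType)
    (d : nat -> measure_display)
    (Omega : forall n : nat, measurableType (d n))
    (P : forall n : nat, probability (Omega n) R)
    (perm1 perm2 : forall n : nat, Omega n -> 'S_n)
    (meas1 : forall n : nat, (0 < n)%N -> random_element (perm1 n))
    (meas2 : forall n : nat, (0 < n)%N -> random_element (perm2 n))
    (unif1 : forall n : nat, (0 < n)%N ->
       uniformly_distributed (P n) (perm1 n))
    (unif2 : forall n : nat, (0 < n)%N ->
       uniformly_distributed (P n) (perm2 n))
    (indep : forall n : nat, (0 < n)%N ->
       independent_elements (P n) (perm1 n) (perm2 n)) :
  limn_esup (fun n : nat =>
    ((n%:R : R) ^+ 2)%:E *
      P n [set w : Omega n | #[perm1 n w]%g = #[perm2 n w]%g]) = +oo.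
Proof.
apply: limn_esup_pinfty => N k.
(* The maximum secures both [N <= n] and [k <= K]; the successor makes [n] positive. *)
pose K := (maxn N k).+1; pose n := fact_tower K.
have n0 : (0 < n)%N by exact: leq_ltn_trans (fact_tower_ge K).
exists n.
  by apply: leq_trans (fact_tower_ge K); rewrite leqW // leq_maxl.
pose l (i : 'I_K) := (n - fact_tower i)%N.
have lt_n (i : 'I_K) : (fact_tower i < n)%N by exact: fact_tower_lt.
have l_inj : injective l.
  move=> i j lij; apply/val_inj/eqP; rewrite eq_sym.
  have /eqP e : fact_tower i == fact_tower j.
    by rewrite -(eqn_add2l (l i)) {2}lij !subnK // ltnW.
  by case: (ltngtP i j) => // /fact_tower_lt; rewrite e ltnn.
have card_l i : (n.-1`! <= #|[set s : 'S_n | #[s]%g == l i]%SET|)%N.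
  apply: card_Sn_order_ge; first by rewrite subn_gt0 lt_n leq_subr.
  (* The complement of an [l i]-cycle has [n - l i = fact_tower i] points. *)
  by rewrite subKn ?dvdn_fact_tower_sub // ltnW.
have lower := probability_eq_comp_ge _ _ _ _ _ _ _ (fun s : 'S_n => #[s]%g) _ l
  (meas1 _ n0) (meas2 _ n0) (unif1 _ n0) (unif2 _ n0) (indep _ n0) l_inj.
apply: le_trans (lee_wpmul2l _ lower); last first.
  by rewrite lee_fin exprn_ge0.
rewrite -EFinM lee_fin card_Sn.
apply: (@le_trans _ _ K%:R); first by rewrite ler_nat leqW // leq_maxr.
rewrite mulr_sumr -[leLHS]mulr1 mulr_natl -[in leLHS](card_ord K) -sumr_const.
(* Since n (n - 1)! = n!, each of the [K] summands, once multiplied by n^2, is the square of a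
   number at least 1. *)
apply: ler_sum => i _; rewrite -exprMn exprn_ege1 // mulrA.
rewrite ler_pdivlMr ?ltr0n ?fact_gt0 // mul1r -natrM ler_nat.
by rewrite -{1}(prednK n0) factS prednK // leq_mul.
Qed.
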